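(* Let $\mathcal I$ be a flat ideal of subsets of $\omega$. Then either $\mathcal I\equiv_T[\mathfrak c]^{<\omega}$ or $\mathcal I$ is gradually flat.
   Context: A submeasure is a map $\varphi\colon\mathcal P(\omega)\to[0,\infty]$ with $\varphi(\emptyset)=0$, monotone and subadditive; it is lower semicontinuous (lsc) if $\varphi(a)=\lim_n\varphi(a\cap[0,n])$. $\mathrm{Fin}(\varphi)=\{a:\varphi(a)<\infty\}$. An lsc submeasure $\varphi$ is flat if for each $M>0$ there is $N>0$ such that for each finite $a\subseteq\omega$ with $\varphi(a)<N$ there is $j$ such that for all $b\subseteq\omega\setminus j$, $\varphi(b)<M$ implies $\varphi(a\cup b)<N$. It is gradual if for each $M>0$ there is $N>0$ such that for each $l$ there is $j$ such that for every family $B$ of at most $l$ subsets of $\omega\setminus j$, $\max_{b\in B}\varphi(b)<M$ implies $\varphi(\bigcup B)<N$. An ideal is flat (resp. gradually flat) if it equals $\mathrm{Fin}(\varphi)$ for some flat (resp. flat and gradual) lsc submeasure $\varphi$. Ideals are ordered by inclusion; $[\mathfrak c]^{<\omega}$ is the set of finite subsets of $2^\omega$ ordered by inclusion. $P\le_T Q$ means there is a map $P\to Q$ sending unbounded sets to unbounded sets, and $P\equiv_T Q$ means $P\le_T Q$ and $Q\le_T P$. *)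

(* Defs.v *)
From mathcomp Require Import all_boot all_order all_algebra.
From mathcomp Require Import all_classical all_reals all_analysis.
Set Implicit Arguments.
Unset Strict Implicit.
Unset Printing Implicit Defensive.
Import Order.TTheory GRing.Theory Num.Theory.
Import numFieldNormedType.Exports.
Local Open Scope classical_set_scope.
Local Open Scope ring_scope.
Local Open Scope ereal_scope.

Section Submeasures.
Variable R : realType.
Implicit Types phi : set nat -> \bar R.

Definition submeasure phi : Prop :=
  [/\ forall a, 0 <= phi a,
      phi set0 = 0,
      forall a b, a `<=` b -> phi a <= phi b &
      forall a b, phi (a `|` b) <= phi a + phi b].

(* `I_n.+1 is the closed initial segment [0, n]. *)
Definition lsc phi : Prop :=
  forall a, phi (a `&` `I_n.+1) @[n --> \oo] --> phi a.

Definition lsc_submeasure phi : Prop := submeasure phi /\ lsc phi.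

Definition Fin_ideal phi : set (set nat) := [set a | phi a < +oo].

(* ~` `I_j is the complement of the ordinal j = {0, ..., j - 1}. *)
Definition flat phi : Prop :=
  forall M : R, (0 < M)%R -> exists N : R, (0 < N)%R /\
    forall a : set nat, finite_set a -> phi a < N%:E ->
      exists j : nat, forall b : set nat, b `<=` ~` `I_j ->
        phi b < M%:E -> phi (a `|` b) < N%:E.

(* B #<= `I_l says that B has at most l elements. *)
Definition gradual phi : Prop :=
  forall M : R, (0 < M)%R -> exists N : R, (0 < N)%R /\
    forall l : nat, exists j : nat, forall B : set (set nat),
      (B #<= `I_l)%card -> (forall b, B b -> b `<=` ~` `I_j) ->
      (forall b, B b -> phi b < M%:E) -> phi (\bigcup_(b in B) b) < N%:E.

Definition flat_ideal (I : set (set nat)) : Prop :=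
  exists phi, [/\ lsc_submeasure phi, flat phi & I = Fin_ideal phi].

Definition gradually_flat_ideal (I : set (set nat)) : Prop :=
  exists phi, [/\ lsc_submeasure phi, flat phi, gradual phi &
                  I = Fin_ideal phi].

End Submeasures.

(* Neither properness nor the inclusion of all finite sets is required. *)
Definition ideal_on_omega (I : set (set nat)) : Prop :=
  [/\ I set0,
      forall a b, a `<=` b -> I b -> I a &
      forall a b, I a -> I b -> I (a `|` b)].

Definition unbounded (P : Type) (leP : P -> P -> Prop) (X : set P) : Prop :=
  ~ exists p, forall x, X x -> leP x p.

Definition tukey_le (P Q : Type) (leP : P -> P -> Prop)
    (leQ : Q -> Q -> Prop) : Prop :=
  exists f : P -> Q,
    forall X : set P, unbounded leP X -> unbounded leQ (f @` X).

Definition tukey_equiv (P Q : Type) (leP : P -> P -> Prop)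
    (leQ : Q -> Q -> Prop) : Prop :=
  tukey_le leP leQ /\ tukey_le leQ leP.

(* A family of sets F, coerced to the type of its members, under inclusion. *)
Definition inclusion_order (T : Type) (F : set (set T)) : F -> F -> Prop :=
  fun a b => \val a `<=` \val b.
Arguments inclusion_order {T} F.

Definition fin_continuum : set (set (nat -> bool)) := [set a | finite_set a].

(* Main.v *)
Require Import Defs.
From mathcomp Require Import all_boot all_order all_algebra.
From mathcomp Require Import all_classical all_reals all_analysis.
Set Implicit Arguments.
Unset Strict Implicit.
Unset Printing Implicit Defensive.
Import Order.TTheory GRing.Theory Num.Theory.
Import numFieldNormedType.Exports.
Local Open Scope classical_set_scope.
Local Open Scope ring_scope.
Local Open Scope ereal_scope.

(** Any flat [phi] with [I = Fin phi] that is not gradual already makes [I]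
    of the Tukey type of the finite subsets of the continuum.  Non-graduality
    yields [M] and, for each [n], a number [l n] such that arbitrarily far out
    there are [l n] finite sets, each of submeasure less than [M], whose union
    has submeasure greater than [n]; call them a block of weight [n].  Place,
    for each pair of a weight [n] and a finite list [s] of binary strings, one
    block [g 0, g 1, ...] of weight [n], so far out that flatness keeps every
    union of one member per block below the constant [N] given by flatness for
    [M].  Let the branch [alpha] pick from the block of [(n, s)] the member
    whose index is the position in [s] of the first string that [alpha]
    extends, and let [x alpha] be the union of its picks, so that
    [phi (x alpha) <= N].  Among infinitely many branches, [l n] of them are
    separated by their restrictions to some common length; listing these
    restrictions as [s], the branches pick up the whole block of [(n, s)].
    Hence no infinite set of [x alpha]'s is bounded in [I]. *)

Lemma ideal_bigcup_finite (I : set (set nat)) (T : eqType) (F : set T)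
    (x : T -> set nat) :
  ideal_on_omega I -> finite_set F -> (forall t, F t -> I (x t)) ->
  I (\bigcup_(t in F) x t).
Proof.
move=> [I0 _ IU] /finite_seqP[s ->]; elim: s => [|t s IHs] Ix.
  by rewrite set_nil bigcup_set0.
have -> : [set` t :: s] = [set t] `|` [set` s].
  apply/seteqP; split=> u /=; rewrite in_cons.
    by case/orP=> [/eqP ->|]; [left|right].
  by case=> ->; rewrite ?eqxx ?orbT.
rewrite bigcup_setU bigcup_set1; apply: IU.
  by apply: Ix; rewrite /= mem_head.
by apply: IHs => u su; apply: Ix; rewrite /= in_cons su orbT.
Qed.

Section TukeyContinuum.
Variable I : set (set nat).
Hypothesis hI : ideal_on_omega I.

(** Send each set to the singleton of its characteristic function. If a finite [p] bounds the images
    of [X], then [X] has only finitely many distinct members, and their union bounds it in [I]. *)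
Lemma ideal_tukey_le_continuum :
  tukey_le (inclusion_order I) (inclusion_order fin_continuum).
Proof.
pose ind (a : set nat) : nat -> bool := fun n => `[< a n >].
have fin1 (a : I) : [set ind (\val a)] \in fin_continuum.
  by apply/mem_set; exact: finite_set1.
exists (fun a => exist (fun F => F \in fin_continuum) _ (fin1 a)) => X Xub [[p pfin] pub].
apply: Xub; pose P := p `&` [set ind (\val a) | a in X].
have Pfin : finite_set P by apply: sub_finite_set (set_mem pfin); exact: subIsetl.
have PI : I (\bigcup_(f in P) [set n | f n]).
  apply: ideal_bigcup_finite => // _ [_ [a _ <-]].
  suff -> : [set n | ind (\val a) n] = \val a by exact: set_mem (valP a).
  by apply/seteqP; split=> n /= /asboolP.
exists (exist (fun a => a \in I) _ (mem_set PI)) => a Xa n /= an.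
exists (ind (\val a)); last exact/asboolP.
split; last by exists a.
exact: (pub _ (ex_intro2 _ _ a Xa erefl) _ erefl).
Qed.

(** Send [F] to the union of its [x f]. An unbounded [X] has infinite union, and a bound of its
    image would contain [x f] for every [f] in that union. *)
Lemma continuum_tukey_le_ideal (x : (nat -> bool) -> set nat) :
    (forall f, I (x f)) ->
    (forall A : set (nat -> bool), infinite_set A ->
      forall p, I p -> ~ (forall f, A f -> x f `<=` p)) ->
  tukey_le (inclusion_order fin_continuum) (inclusion_order I).
Proof.
move=> Ix xub.
have IF (F : fin_continuum) : \bigcup_(f in \val F) x f \in I.
  apply/mem_set; apply: ideal_bigcup_finite => //.
  exact: set_mem (valP F).
exists (fun F => exist (fun a => a \in I) _ (IF F)) => X Xub [[p pI] pub].
pose A := \bigcup_(F in X) (\val F : set (nat -> bool)).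
have Ainf : infinite_set A.
  move=> Afin; apply: Xub; exists (exist (fun F => F \in fin_continuum) A (mem_set Afin)) => F XF f /= Ff.
  by exists F.
apply: (xub A Ainf p (set_mem pI)) => f [F XF Ff] n xn.
exact: (pub _ (ex_intro2 _ _ F XF erefl) n (ex_intro2 _ _ f Ff xn)).
Qed.

End TukeyContinuum.

Section Blocks.
Variables (R : realType) (phi : set nat -> \bar R).
Hypothesis hphi : lsc_submeasure phi.

Lemma lsc_exists_lt (a : set nat) (y : \bar R) :
  y < phi a -> exists m, y < phi (a `&` `I_m).
Proof.
move=> ya; apply: contrapT => /forallNP small.
move: ya; apply/negP; rewrite -leNgt.
apply: (cvge_to_le (hphi.2 a)); apply: nearW => m.
by rewrite leNgt; apply/negP; exact: small.
Qed.

Lemma nongradual_blocks : ~ gradual phi ->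
  exists2 M : R, (0 < M)%R & exists l : nat -> nat, forall n j,
    exists g : nat -> set nat, exists m,
    [/\ forall i, g i `<=` ~` `I_j, forall i, g i `<=` `I_m,
        forall i, phi (g i) < M%:E &
        n%:R%:E < phi (\bigcup_(i in `I_(l n)) g i)].
Proof.
have [[_ phi0 phiS _] _] := hphi.
move=> /existsNP[M /not_implyP[M0 /forallNP hM]]; exists M => //.
suff /choice[l hl] : forall n, exists l, forall j,
    exists g : nat -> set nat, exists m,
    [/\ forall i, g i `<=` ~` `I_j, forall i, g i `<=` `I_m,
        forall i, phi (g i) < M%:E &
        n%:R%:E < phi (\bigcup_(i in `I_l) g i)] by exists l.
(* The threshold n + 1 is positive and leaves strict room above n, which the truncation at [m] uses
   up. *)
move=> n; have /not_andP[|/existsNP[l /forallNP hl]] := hM n.+1%:R.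
  by rewrite ltr0Sn.
exists l => j.
have /existsNP[B /not_implyP[/pcard_leP[f] /not_implyP[Bj
  /not_implyP[BM /negP]]]] := hl j.
rewrite -leNgt => BN.
have {BN}[m hm] : exists m, n%:R%:E < phi (\bigcup_(b in B) b `&` `I_m).
  by apply: lsc_exists_lt; apply: lt_le_trans BN; rewrite lte_fin ltr_nat.
(* Since [f] is injective on [B], this is the truncation of the only member of index [i], or empty
   if there is none. *)
pose g i := \bigcup_(b in B `&` [set b | f b = i]) b `&` `I_m.
have gP i : g i = set0 \/ exists2 b, B b & g i `<=` b.
  have [[b [Bb fb]]|nb] := pselect (exists b, B b /\ f b = i).
    right; exists b => // k [[c [Bc /= fc] ck] _].
    suff <- : c = b by [].
    by apply: (@inj _ _ B f); [exact: mem_set..|exact: etrans fc (esym fb)].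
  left; apply/seteqP; split=> // k [[b [Bb fb] _] _].
  by apply: nb; exists b.
exists g, m; split.
- by move=> i; case: (gP i) => [->//|[b Bb gb]]; apply: subset_trans gb (Bj _ Bb).
- by move=> i; exact: subIsetr.
- move=> i; case: (gP i) => [->|[b Bb gb]]; first by rewrite phi0 lte_fin.
  exact: le_lt_trans (phiS _ _ gb) (BM _ Bb).
- apply: lt_le_trans hm _; apply: phiS => k [[b Bb bk] mk].
  exists (f b); first exact: (@funS _ _ B `I_l f).
  by split=> //; exists b.
Qed.

(** The segment below [m] has finitely many subsets, so the largest of their [j] serves them all. *)
Lemma flat_uniform (M N : R) :
    (forall a, finite_set a -> phi a < N%:E ->
      exists j, forall b, b `<=` ~` `I_j -> phi b < M%:E ->
        phi (a `|` b) < N%:E) ->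
  forall m, exists j, forall a b, a `<=` `I_m -> phi a < N%:E ->
    b `<=` ~` `I_j -> phi b < M%:E -> phi (a `|` b) < N%:E.
Proof.
move=> hN m.
pose S (A : {set 'I_m}) : set nat := [set (i : nat) | i in [set` A]].
have /choice[J hJ] : forall A, exists j, phi (S A) < N%:E ->
    forall b, b `<=` ~` `I_j -> phi b < M%:E -> phi (S A `|` b) < N%:E.
  move=> A; have [SN|] := pselect (phi (S A) < N%:E); last by exists 0%N.
  have [|j hj] := hN (S A) _ SN; first exact: finite_image.
  by exists j.
exists (\max_(A : {set 'I_m}) J A)%N => a b am aN bj bM.
have aE : a = S [set i | `[< a (i : 'I_m) >]]%SET.
  apply/seteqP; split=> [k ak|_ [i /= + <-]]; last by rewrite inE => /asboolP.
  by exists (Ordinal (am _ ak)) => //=; rewrite inE; apply/asboolP.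
rewrite aE; apply: hJ => //; rewrite -?aE//.
apply: subset_trans bj _ => k /= /negP; rewrite -leqNgt => kJ.
apply/negP; rewrite -leqNgt; apply: leq_trans kJ.
exact: (leq_bigmax (F := J)).
Qed.

(** By flatness, adding one member of the next block keeps a finite union below [N]; lower
    semicontinuity passes to the infinite union, at the price of a weak inequality. *)
Lemma block_sequence : flat phi -> ~ gradual phi ->
  exists N : R, exists l : nat -> nat, forall w : nat -> nat,
  exists g : nat -> nat -> set nat,
    (forall c : nat -> nat, phi (\bigcup_k g k (c k)) <= N%:E) /\
    (forall k, (w k)%:R%:E < phi (\bigcup_(i in `I_(l (w k))) g k i)).
Proof.
have [[_ phi0 phiS _] _] := hphi.
move=> hflat /nongradual_blocks[M M0 [l hl]].
have [N [N0 /flat_uniform hN]] := hflat M M0.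
exists N, l => w.
have /choice[G hG] : forall nm : nat * nat, exists gm : (nat -> set nat) * nat,
    [/\ forall i, gm.1 i `<=` ~` `I_nm.2, forall i, gm.1 i `<=` `I_gm.2,
      (nm.2 < gm.2)%N,
      forall a i, a `<=` `I_nm.2 -> phi a < N%:E ->
        phi (a `|` gm.1 i) < N%:E &
      nm.1%:R%:E < phi (\bigcup_(i in `I_(l nm.1)) gm.1 i)].
  move=> [n m]; have [j hj] := hN m.
  (* Beyond [j] flatness applies; beyond [m] the block clears all earlier ones. *)
  have [g [m' [gj gm' gM gn]]] := hl n (maxn j m).
  exists (g, maxn m' m.+1); split=> //=.
  - move=> i k /gj/= /negP; rewrite -leqNgt geq_max => /andP[_ mk].
    by apply/negP; rewrite -leqNgt.
  - by move=> i k /gm'/= km'; rewrite leq_max km'.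
  - by rewrite leq_max ltnSn orbT.
  - move=> a i am aN; apply: hj => // k /gj/= /negP.
    by rewrite -leqNgt geq_max => /andP[jk _]; apply/negP; rewrite -leqNgt.
pose fix m k := if k is k'.+1 then (G (w k', m k')).2 else 0%N.
pose g k := (G (w k, m k)).1.
have mk k : (k <= m k)%N.
  elim: k => // k IHk; apply: leq_ltn_trans IHk _ => /=.
  by case: (hG (w k, m k)).
exists g; split=> [c|k]; last by case: (hG (w k, m k)).
have part k : \bigcup_(i in `I_k) g i (c i) `<=` `I_(m k) /\
    phi (\bigcup_(i in `I_k) g i (c i)) < N%:E.
  elim: k => [|k [IHm IHN]]; first by rewrite II0 bigcup_set0 phi0 lte_fin; split.
  have [/= _ gm' mm' gN _] := hG (w k, m k).
  have -> : \bigcup_(i in `I_k.+1) g i (c i)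
      = \bigcup_(i in `I_k) g i (c i) `|` g k (c k).
    by rewrite IIS bigcup_setU bigcup_set1.
  split; last exact: gN.
  by move=> p [/IHm/= pm|/gm'//]; exact: ltn_trans mm'.
apply: (cvge_to_le (hphi.2 _)); apply: nearW => n.
(* Block [k] starts at or after [m k], hence after [k], so [0, n] meets only the first n + 1
   blocks. *)
apply: le_trans (ltW (part n.+1).2); apply: phiS => p [[k _ gp] /= pn].
exists k => //=; apply: leq_ltn_trans pn.
have [/(_ _ _ gp)/= /negP + _ _ _ _] := hG (w k, m k).
by rewrite -leqNgt; apply: leq_trans.
Qed.

End Blocks.

(** If no string fits, the value is [size s]; this is harmless, as the bound on unions of picks
    holds for arbitrary indices. *)
Definition first_prefix (f : nat -> bool) (s : seq (seq bool)) : nat :=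
  find (fun t => t == mkseq f (size t)) s.

(** Any [l] distinct members of [A] differ pairwise below some common length [m]; their restrictions
    to [m] form [s]. *)
Lemma separating_prefixes (A : set (nat -> bool)) (l : nat) :
  infinite_set A ->
  exists s, forall i, (i < l)%N -> exists2 f, A f & first_prefix f s = i.
Proof.
move=> /infiniteP/pcard_leP[h].
have hA i : A (h i) by exact: (@funS _ _ setT A h).
have /choice[d hd] : forall ij : nat * nat, exists p,
    ij.1 != ij.2 -> h ij.1 p != h ij.2 p.
  move=> [i j] /=; have [->|ij] := eqVneq i j; first by exists 0%N.
  have /existsNP[p hp] : ~ (forall p, h i p = h j p).
    by move=> /funext/inj hij; move: ij; rewrite hij ?inE// eqxx.
  by exists p => _; apply/eqP.
have [m dm] : exists m, forall i j, (i < l)%N -> (j < l)%N -> (d (i, j) < m)%N.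
  exists (\max_(i < l) \max_(j < l) d (i : nat, j : nat)).+1 => i j il jl.
  rewrite ltnS; apply: leq_trans (leq_bigmax (Ordinal il)).
  exact: leq_trans (leq_bigmax (Ordinal jl)).
exists [seq mkseq (h i) m | i <- iota 0 l] => i il; exists (h i) => //.
rewrite /first_prefix find_map.
rewrite (@eq_in_find _ _ (pred1 i)); last first.
  move=> j; rewrite mem_iota add0n => /andP[_ jl] /=; rewrite size_mkseq.
  apply/eqP/eqP => [|->//] hij; apply/eqP; apply: contraT => ji.
  have := hd (j, i) ji; have := congr1 (nth false ^~ (d (j, i))) hij.
  by rewrite /= !nth_mkseq ?dm// => ->; rewrite eqxx.
rewrite -[LHS]/(index i (iota 0 l)) -[X in index X _](@nth_iota 0%N 0%N l)//.
by rewrite index_uniq ?size_iota ?iota_uniq.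
Qed.

Lemma nongradual_continuum_tukey_le (R : realType) (phi : set nat -> \bar R) :
    lsc_submeasure phi -> flat phi -> ~ gradual phi ->
    ideal_on_omega (Fin_ideal phi) ->
  tukey_le (inclusion_order fin_continuum) (inclusion_order (Fin_ideal phi)).
Proof.
move=> hphi hflat hgrad hI; have [[_ _ phiS _] _] := hphi.
have [N [l hl]] := block_sequence hphi hflat hgrad.
(* Every pair of a weight and a list occurs as some [r k]; a number coding no pair merely repeats
   the default one. *)
pose r (k : nat) : nat * seq (seq bool) := odflt (0%N, [::]) (unpickle k).
have [g [gN gw]] := hl (fun k => (r k).1).
pose x f := \bigcup_k g k (first_prefix f (r k).2).
apply: (@continuum_tukey_le_ideal _ hI x) => [f|A Ainf p pfin xp].
  exact: le_lt_trans (gN _) (ltry _).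
have phip n : n%:R%:E < phi p.
  have [s hs] := separating_prefixes (l n) Ainf.
  pose k := pickle (n, s).
  have rk : r k = (n, s) by rewrite /r /k pickleK.
  have := gw k; rewrite rk /= => /lt_le_trans; apply; apply: phiS.
  move=> q [i /= il gq]; have [f Af fi] := hs i il.
  by apply: (xp f Af); exists k => //; rewrite rk /= fi.
move: pfin phip; rewrite /Fin_ideal /=; case: (phi p) => [y _|//|_ /(_ 0%N)//].
move=> /(_ (Num.bound `|y|%R)); rewrite lte_fin ltNge.
by rewrite (le_trans (ler_norm y))// ltW ?archi_boundP.
Qed.

Theorem theorem4p2 (R : realType) (I : set (set nat))
  (hI : ideal_on_omega I) (hflat : flat_ideal R I) :
  tukey_equiv (inclusion_order I) (inclusion_order fin_continuum) \/ gradually_flat_ideal R I.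
Proof.
have [phi [hphi phiflat IE]] := hflat.
have [hgrad|hgrad] := pselect (gradual phi); first by right; exists phi.
left; split; first exact: ideal_tukey_le_continuum.
by move: hI; rewrite IE; exact: nongradual_continuum_tukey_le.
Qed.
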